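(* Let $T_{\mathrm{PC}}=\Delta((0,0)^{\mathsf T},(0,1)^{\mathsf T},(1,1)^{\mathsf T})\subset\mathbb{R}^2$ and, for $N\ge1$, let $\mathcal{P}$ be a list of points $\boldsymbol{x}_1,\dots,\boldsymbol{x}_N\in T_{\mathrm{PC}}$. Then $$D_N^{\mathrm{PC}}(\mathcal{P};T_{\mathrm{PC}})\le 2D_N^{\mathrm{P}}(\mathcal{P};T_{\mathrm{PC}})\quad\text{and}\quad \bar D_N^{\mathrm{PC}}(\mathcal{P};T_{\mathrm{PC}})\le 2\bar D_N^{\mathrm{P}}(\mathcal{P};T_{\mathrm{PC}}).$$
   Context: For non-collinear points $A,B,C$, $\Delta(A,B,C)=\{\omega_1A+\omega_2B+\omega_3C : \omega_j\ge 0,\ \omega_1+\omega_2+\omega_3=1\}$ is the closed triangle they span; $\mathbf{vol}$ is two-dimensional Lebesgue measure. Discrepancies. Let $\Omega$ be a triangle in $\mathbb{R}^2$ and $\mathcal{P}=(\boldsymbol{x}_1,\dots,\boldsymbol{x}_N)$ a list of points. For measurable $S\subset\mathbb{R}^2$ put $\delta_N(S;\mathcal{P},\Omega)=\mathbf{vol}(S\cap\Omega)/\mathbf{vol}(\Omega)-\frac1N\sum_{i=1}^N1_{\boldsymbol{x}_i\in S}$ and, counting all integer shifts of the points, $\bar\delta_N(S;\mathcal{P},\Omega)=\mathbf{vol}(S\cap\Omega)/\mathbf{vol}(\Omega)-\frac1N\sum_{\boldsymbol{m}\in\mathbb{Z}^2}\sum_{i=1}^N1_{\boldsymbol{x}_i+\boldsymbol{m}\in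 S}$. For a class $\mathcal{S}$ of sets, $D_N(\mathcal{S};\mathcal{P},\Omega)=\sup_{S\in\mathcal{S}}|\delta_N(S;\mathcal{P},\Omega)|$ and $\bar D_N(\mathcal{S};\mathcal{P},\Omega)=\sup_{S\in\mathcal{S}}|\bar\delta_N(S;\mathcal{P},\Omega)|$. Anchored-box discrepancy: $D_N^{\mathrm{PC}}(\mathcal{P};T_{\mathrm{PC}})=D_N(\mathcal{S}_I;\mathcal{P},T_{\mathrm{PC}})$ and $\bar D_N^{\mathrm{PC}}(\mathcal{P};T_{\mathrm{PC}})=\bar D_N(\mathcal{S}_I;\mathcal{P},T_{\mathrm{PC}})$, where $\mathcal{S}_I=\{[0,a_1)\times[0,a_2): (a_1,a_2)\in[0,1)^2\}$. Parallelogram discrepancy: for $\Omega=\Delta(A,B,C)$ and $a,b\in(0,1]$ let $\mathcal{T}_{a,b,C}=\{C+s(A-C)+t(B-C): 0\le s\le a,\ 0\le t\le b\}$, let $\mathcal{S}_C=\{\mathcal{T}_{a,b,C}:0<a\le1,\ 0<b\le1\}$, define $\mathcal{S}_A,\mathcal{S}_B$ analogously (vertex $A$, resp. $B$, with side vectors along the two triangle sides leaving that vertex), and $\mathcal{S}_{\mathrm{P}}=\mathcal{S}_A\cup\mathcal{S}_B\cup\mathcal{S}_C$. Then $D_N^{\mathrm{P}}(\mathcal{P};\Omega)=D_N(\mathcal{S}_{\mathrm{P}};\mathcal{P},\Omega)$ and $\bar D_N^{\mathrm{P}}(\mathcal{P};\Omega)=\bar D_N(\mathcal{S}_{\mathrm{P}};\mathcal{P},\Omega)$.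 *)

(* Defs.v *)
From HB Require Import structures.
From mathcomp Require Import all_boot all_order all_algebra.
From mathcomp Require Import all_classical all_reals all_analysis.

Set Implicit Arguments.
Unset Strict Implicit.
Unset Printing Implicit Defensive.

Import Order.TTheory GRing.Theory Num.Theory.
Import numFieldNormedType.Exports.

Local Open Scope classical_set_scope.
Local Open Scope ring_scope.
Local Open Scope ereal_scope.

(* The plane is [R * R], with its product measurable structure and its
   componentwise vector-space structure. *)

Definition vol (R : realType) (S : set (R * R)) : \bar R :=
  ((@lebesgue_measure R) \x (@lebesgue_measure R)) S.

Definition triangle (R : realType) (A B C : R * R) : set (R * R) :=
  [set w.1.1 *: A + w.1.2 *: B + w.2 *: C | w in
    [set w : R * R * R | [/\ 0 <= w.1.1, 0 <= w.1.2, 0 <= w.2 &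
                             w.1.1 + w.1.2 + w.2 = 1]]]%R.

Definition local_discrepancy (R : realType) (N : nat) (x : N.-tuple (R * R))
    (Omega S : set (R * R)) : \bar R :=
  vol (S `&` Omega) / vol Omega
  - ((N%:R)^-1 * \sum_(i < N) \1_S (tnth x i))%R%:E.

Definition int_shift (R : realType) (p : R * R) (m : int * int) : R * R :=
  (p.1 + m.1%:~R, p.2 + m.2%:~R)%R.

(* The sum over the shifts is unrestricted, so it is [+oo] when infinitely many
   shifted points lie in [S]. *)
Definition shifted_local_discrepancy (R : realType) (N : nat)
    (x : N.-tuple (R * R)) (Omega S : set (R * R)) : \bar R :=
  vol (S `&` Omega) / vol Omega
  - ((N%:R)^-1)%R%:E *
    \esum_(m in [set: int * int])
      (\sum_(i < N) \1_S (int_shift (tnth x i) m))%R%:E.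

Definition discrepancy (R : realType) (SS : set (set (R * R))) (N : nat)
    (x : N.-tuple (R * R)) (Omega : set (R * R)) : \bar R :=
  ereal_sup [set `|local_discrepancy x Omega S| | S in SS].

Definition shifted_discrepancy (R : realType) (SS : set (set (R * R)))
    (N : nat) (x : N.-tuple (R * R)) (Omega : set (R * R)) : \bar R :=
  ereal_sup [set `|shifted_local_discrepancy x Omega S| | S in SS].

Definition anchored_boxes (R : realType) : set (set (R * R)) :=
  [set `[0%R, a.1[ `*` `[0%R, a.2[ | a in
    [set a : R * R | (0 <= a.1 < 1)%R /\ (0 <= a.2 < 1)%R]].

Definition parallelogram (R : realType) (V P Q : R * R) (a b : R) :
    set (R * R) :=
  [set V + st.1 *: (P - V) + st.2 *: (Q - V) | st in
    [set st : R * R | 0 <= st.1 <= a /\ 0 <= st.2 <= b]]%R.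

Definition vertex_parallelograms (R : realType) (V P Q : R * R) :
    set (set (R * R)) :=
  [set parallelogram V P Q ab.1 ab.2 | ab in
    [set ab : R * R | (0 < ab.1 <= 1)%R /\ (0 < ab.2 <= 1)%R]].

Definition parallelograms (R : realType) (A B C : R * R) :
    set (set (R * R)) :=
  vertex_parallelograms A B C `|` vertex_parallelograms B A C
  `|` vertex_parallelograms C A B.

(* The triangle is passed by its vertices, which also determine the class of
   parallelograms. *)
Definition parallelogram_discrepancy (R : realType) (N : nat)
    (x : N.-tuple (R * R)) (A B C : R * R) : \bar R :=
  discrepancy (parallelograms A B C) x (triangle A B C).

Definition shifted_parallelogram_discrepancy (R : realType) (N : nat)
    (x : N.-tuple (R * R)) (A B C : R * R) : \bar R :=
  shifted_discrepancy (parallelograms A B C) x (triangle A B C).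

Definition T_PC (R : realType) : set (R * R) :=
  triangle (0, 0)%R (0, 1)%R (1, 1)%R.

Definition PC_discrepancy (R : realType) (N : nat) (x : N.-tuple (R * R)) :
    \bar R :=
  discrepancy (@anchored_boxes R) x (@T_PC R).

Definition shifted_PC_discrepancy (R : realType) (N : nat)
    (x : N.-tuple (R * R)) : \bar R :=
  shifted_discrepancy (@anchored_boxes R) x (@T_PC R).

(* Main.v *)
(* The parallelograms at the vertex (0, 1) are the boxes [0, b] x [1 - a, 1], so
   the difference of two of them is [0, b] x [0, a2), and [0, a1) x [0, a2) is
   the increasing union of these differences as b increases to a1.  The
   discrepancy of the anchored box is thus a limit of differences of two
   discrepancies of parallelograms, whence the factor 2.  This applies to
   shifted points as well, since only finitely many of them lie in the unit
   square. *)
Require Import Defs.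
From HB Require Import structures.
From mathcomp Require Import all_boot all_order all_algebra.
From mathcomp Require Import all_classical all_reals all_analysis.
From mathcomp Require Import ring lra zify.

Set Implicit Arguments.
Unset Strict Implicit.
Unset Printing Implicit Defensive.

Import Order.TTheory GRing.Theory Num.Theory.
Import numFieldNormedType.Exports.

Local Open Scope classical_set_scope.
Local Open Scope ring_scope.
Local Open Scope ereal_scope.

(** * Geometry of the triangle and volumes inside the unit square *)

Definition unit_square (R : realType) : set (R * R) :=
  `[0%R, 1%R] `*` `[0%R, 1%R].

Lemma scale_mulE (R : realType) (a b : R) : (a *: b = a * b)%R.
Proof. by []. Qed.

Lemma parallelogram_box (R : realType) (a b : R) :
  parallelogram (0, 1)%R (0, 0)%R (1, 1)%R a b =
  `[0%R, b] `*` `[(1 - a)%R, 1%R].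
Proof.
apply/seteqP; split => [_ [[s t] /= [sa tb] <-]|[u v] /= []].
  split; rewrite /= in_itv /=; rewrite /= !scale_mulE; lra.
rewrite !in_itv /= => ub va; exists (1 - v, u)%R => /=; first by split; lra.
by congr pair; rewrite /= !scale_mulE; ring.
Qed.

Lemma measurable_T_PC (R : realType) : measurable (@T_PC R).
Proof.
(* The barycentric weights of [(u, v)] are [1 - v], [v - u] and [u]; their signs cut out the part of
   the square on or above the diagonal. *)
have -> : @T_PC R = (`[0%R, 1%R] `*` `[0%R, 1%R]) `&`
    ((fun p : R * R => p.2 - p.1)%R @^-1` `[0%R, +oo[).
  apply/seteqP; split =>
      [_ [[[w1 w2] w3] /= [w1_ge0 w2_ge0 w3_ge0 wS] <-]|[u v]].
    by rewrite /= !scale_mulE !in_itv /= andbT; split => [|]; last lra;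
      split; lra.
  rewrite /= !in_itv /= andbT => -[[u01 v01] uv].
  exists ((1 - v, v - u), u)%R => /=; first by split; lra.
  by congr pair; rewrite /= !scale_mulE; ring.
apply: measurableI; first exact: measurableX.
rewrite -[X in measurable X]setTI.
have : measurable_fun [set: R * R] (fun p => p.2 - p.1)%R.
  apply: measurable_realfun.measurable_funB; first exact: measurable_snd.
  exact: measurable_fst.
by apply.
Qed.

Lemma vol_unit_square (R : realType) : vol (@unit_square R) = 1.
Proof.
rewrite /vol product_measure1E //= lebesgue_measure_itv /= lte_fin ltr01.
by rewrite oppr0 adde0 mule1.
Qed.

Lemma vol_fin_num (R : realType) (S Omega : set (R * R)) :
  measurable S -> measurable Omega -> S `<=` @unit_square R ->
  vol (S `&` Omega) \is a fin_num.
Proof.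
move=> mS mO SI; rewrite ge0_fin_numE ?measure_ge0 //.
apply: (@le_lt_trans _ _ (vol (@unit_square R))).
  by apply: le_measure; rewrite ?inE; [exact: measurableI|exact: measurableX|
    move=> p [/SI]].
by rewrite vol_unit_square ltry.
Qed.

(** * Reduction to real-valued discrepancies, their additivity and continuity *)

(** If [vol Omega] is zero, monotonicity makes every numerator zero and [r = 0] serves; otherwise
    the inverse of [vol Omega] is finite. As [r] is independent of [S], differences and limits in
    [S] can be taken among real numbers. *)
Lemma vol_ratioE (R : realType) (Omega : set (R * R)) :
  measurable Omega -> exists r : R, forall S : set (R * R),
    measurable S -> S `<=` @unit_square R ->
    vol (S `&` Omega) / vol Omega = (r * fine (vol (S `&` Omega)))%:E.
Proof.
move=> mO; have [volO|volO] := eqVneq (vol Omega) 0.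
  exists 0%R; move=> S mS SI; rewrite mul0r.
  suff -> : vol (S `&` Omega) = 0; first by rewrite mul0e.
  apply/eqP; rewrite eq_le measure_ge0 andbT -volO.
  by apply: le_measure; rewrite ?inE //; exact: measurableI.
exists (fine (vol Omega)^-1); move=> S mS SI.
rewrite EFinM fineK ?fineK ?vol_fin_num // 1?muleC //.
have : 0 <= vol Omega by exact: measure_ge0.
by case: (vol Omega) volO => [s||] //= s0 _; rewrite inver -eqe (negbTE s0).
Qed.

(* Common form of both local discrepancies on subsets of the unit square: [r] is
   the inverse of the volume of [Omega], [c] is [1 / N], and [L] lists the
   points, shifted or not. *)
Definition real_discrepancy (R : realType) (Omega : set (R * R)) (r c : R)
    (L : seq (R * R)) (S : set (R * R)) : R :=
  (r * fine (vol (S `&` Omega)) - c * \sum_(p <- L) \1_S p)%R.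

(** Volume and point count are both additive; containment in the square keeps the volumes finite, so
    that they may be subtracted. *)
Lemma real_discrepancy_setD (R : realType) (Omega : set (R * R)) (r c : R) L
    (S S' : set (R * R)) :
  measurable Omega -> measurable S -> measurable S' ->
  S `<=` @unit_square R -> S' `<=` S ->
  (real_discrepancy Omega r c L (S `\` S') =
   real_discrepancy Omega r c L S - real_discrepancy Omega r c L S')%R.
Proof.
move=> mO mS mS' SI S'S; rewrite /real_discrepancy.
have -> : vol ((S `\` S') `&` Omega) = vol (S `&` Omega) - vol (S' `&` Omega).
  have -> : (S `\` S') `&` Omega = (S `&` Omega) `\` (S' `&` Omega).
    apply/seteqP; split => p /=; tauto.
  rewrite /vol measureD //; [|exact: measurableI..|].
    congr (_ - vol _); apply/seteqP; split => p /=; first tauto.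
    by move=> [/[dup] /S'S]; tauto.
  by rewrite -ge0_fin_numE ?measure_ge0 //; exact: vol_fin_num.
rewrite fineB ?vol_fin_num //; last exact: subset_trans SI.
have -> : (\sum_(p <- L) \1_(S `\` S') p =
           \sum_(p <- L) \1_S p - \sum_(p <- L) \1_S' p :> R)%R.
  rewrite -sumrB; apply: eq_bigr => p _.
  rewrite !indicE in_setD; have [/set_mem /S'S /mem_set ->|] := boolP (p \in S').
    by rewrite /= subrr.
  by rewrite andbT subr0.
ring.
Qed.

(** The volume term converges by continuity from below, the counting term because [L] is finite and
    the indicator at each point is eventually constant. *)
Lemma cvg_real_discrepancy (R : realType) (Omega : set (R * R)) (r c : R) L
    (S : nat -> set (R * R)) :
  measurable Omega -> (forall n, measurable (S n)) ->
  {homo S : n m / (n <= m)%N >-> (n <= m)%O} ->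
  \bigcup_n S n `<=` @unit_square R ->
  (real_discrepancy Omega r c L (S n) @[n --> \oo] -->
   real_discrepancy Omega r c L (\bigcup_n S n))%R.
Proof.
move=> mO mS ndS SI; apply: cvgB; apply: cvgMl_tmp.
  apply: fine_cvg; rewrite fineK; last first.
    by apply: vol_fin_num => //; exact: bigcup_measurable.
  rewrite setI_bigcupl; apply: nondecreasing_cvg_mu => [n||n m nm].
  - by have := mS n => ?; exact: measurableI.
  - by apply: bigcup_measurable => n _; have := mS n => ?; exact: measurableI.
  - by rewrite subsetEset; apply: setSI; rewrite -subsetEset; exact: ndS.
elim: L => [|p L IH].
  under eq_fun do rewrite big_nil.
  by rewrite big_nil; exact: cvg_cst.
under eq_fun do rewrite big_cons.
rewrite big_cons; apply: cvgD IH.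
apply: cvg_near_cst; have [[n _ Snp]|Sp] := pselect ((\bigcup_n S n) p).
  exists n => // m /= nm; rewrite !indicE !mem_set //; first by exists n.
  by move: Snp; apply/subsetPset; exact: ndS.
near=> n; rewrite !indicE !memNset // => Snp; apply: Sp; by exists n.
Unshelve. all: by end_near. Qed.

(** * Anchored boxes as limits of differences of parallelograms *)

(** The index [n.+2] makes the width positive already at [n = 0], as the side parameters of a
    parallelogram must be. *)
Lemma box_bigcup (R : realType) (a : R) (Y : set R) : (0 < a)%R ->
  \bigcup_n (`[0%R, (a * (1 - n.+2%:R^-1))%R] `*` Y) = `[0%R, a[ `*` Y.
Proof.
move=> a0; apply/seteqP; split => [[u v] [n _]|[u v]] /=; rewrite !in_itv /=.
  move=> [/andP[u0 un] vY]; split => //; rewrite u0 (le_lt_trans un) //.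
  by rewrite gtr_pMr // gtrBl invr_gt0.
move=> [/andP[u0 ua] vY].
(* The point [u] lies below [a * (1 - n.+2%:R^-1)] once [n.+2%:R^-1] is less than [(a - u) / a]. *)
have e0 : (0 < (a - u) / a)%R by rewrite divr_gt0 // subr_gt0.
have [n _ /(_ n.+1 (leqnSn n)) /= nP] := near_infty_natSinv_lt (PosNum e0).
exists n => //; split => //=; rewrite in_itv /= u0 /=.
by move: nP; rewrite ltr_pdivlMr //=; move: (n.+2%:R^-1)%R => i; nra.
Qed.

(** Keeping [d] abstract lets one argument serve both the plain and the shifted discrepancy. *)
Lemma anchored_discrepancy_le (R : realType) (Omega : set (R * R)) (r c : R) L
    (d : set (R * R) -> \bar R) :
  measurable Omega ->
  (forall S, measurable S -> S `<=` @unit_square R ->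
    d S = (real_discrepancy Omega r c L S)%:E) ->
  ereal_sup [set `|d S| | S in @anchored_boxes R] <=
  2%:E * ereal_sup
    [set `|d S| | S in parallelograms (0, 0)%R (0, 1)%R (1, 1 : R)%R].
Proof.
move=> mO dE; set D := ereal_sup [set `|d S| | S in parallelograms _ _ _].
set G := real_discrepancy Omega r c L in dE *.
pose P b e : set (R * R) := `[0%R, b] `*` `[e, 1%R].
have mP b e : measurable (P b e) by exact: measurableX.
have PI b e : (b <= 1)%R -> (0 <= e)%R -> P b e `<=` @unit_square R.
  move=> b1 e0 [u v]; rewrite /P /unit_square /= !in_itv /= => -[uP vP].
  by split; lra.
(* The class of the vertex [(0, 1)] is the one selected by [left; right]. *)
have dP b e : (0 < b <= 1)%R -> (0 <= e < 1)%R -> `|G (P b e)|%:E <= D.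
  move=> b01 e01; apply: ereal_sup_ubound; exists (P b e); last first.
    by rewrite dE //; apply: PI; lra.
  left; right; exists (1 - e, b)%R => /=; first by split; lra.
  by rewrite parallelogram_box subKr.
(* The whole square is one of the parallelograms. Hence [D] is not [-oo], and for [D = +oo] the
   bound is trivial, which leaves a real [D]. *)
have D0 : 0 <= D.
  by apply: le_trans (dP 1%R 0%R _ _); rewrite ?lee_fin //; lra.
apply: ge_ereal_sup => _ [_ [[a1 a2] /= [a1b a2b] <-] <-].
have mS b : measurable (`[0%R, b[ `*` `[0%R, a2[ : set (R * R)).
  exact: measurableX.
rewrite dE //; last first.
  by move=> [u v]; rewrite /unit_square /= !in_itv /= => -[uP vP]; split; lra.
case: D D0 dP => [D D0 dP||//]; last first.
  by move=> _ _; rewrite mulry gtr0_sg // mul1e leey.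
rewrite -EFinM lee_fin.
have [a10|a10] := leP a1 0%R.
  suff -> : `[0%R, a1[ `*` `[0%R, a2[ = set0 :> set (R * R).
    rewrite /G /real_discrepancy set0I /vol measure0 /= mulr0 big1 ?mulr0.
      by rewrite subr0 normr0 mulr_ge0 // -lee_fin.
    by move=> p _; rewrite indic0.
  by apply/seteqP; split => -[u v] //=; rewrite !in_itv /= => -[uP vP]; lra.
pose b n : R := (a1 * (1 - n.+2%:R^-1))%R.
have inv2 n : (0 < (n.+2%:R^-1 : R) < 1)%R.
  by rewrite invr_gt0 ltr0Sn invf_lt1 ?ltr0Sn // ltr1n.
have b01 n : (0 < b n <= 1)%R.
  move: (inv2 n); rewrite /b; move: (n.+2%:R^-1)%R => i i01.
  by apply/andP; split; nra.
rewrite -box_bigcup //.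
(* Removing a closed box takes away its lower edge too, so the second side is half-open already;
   only the first side needs a limit. *)
have SE n : `[0%R, b n] `*` `[0%R, a2[ = P (b n) 0%R `\` P (b n) a2.
  apply/seteqP; split => -[u v] /=; rewrite /P /= !in_itv /= => -[].
    by move=> uP vP; split => [|[_ vP']]; [split; lra|lra].
  move=> [uP vP] NP; split => //; case/andP: vP => -> v1 /=.
  by rewrite ltNge; apply/negP => a2v; apply: NP; split => //; lra.
have cvG : (`|G (`[0%R, b n] `*` `[0%R, a2[)| @[n --> \oo] -->
    `|G (\bigcup_n (`[0%R, b n] `*` `[0%R, a2[))|)%R.
  apply: cvg_norm; apply: cvg_real_discrepancy => //.
  - by move=> n; exact: measurableX.
  - move=> n m nm; rewrite subsetEset => -[u v] /=; rewrite !in_itv /=.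
    move=> [/andP[-> un] ->]; split => //=; apply: (le_trans un).
    by rewrite ler_pM2l // lerD2l lerN2 lef_pV2 ?posrE // ler_nat.
  - move=> [u v] [n _]; rewrite SE => -[+ _]; apply: PI => //.
    by case/andP: (b01 n).
(* The non-strict bound survives the limit, so the triangle inequality for each [n] suffices. *)
apply: (@closed_cvg _ _ \oo _ _ (fun y : R => y <= 2 * D)%R _ _ _ cvG).
  exact: closed_le.
near=> n; rewrite SE /G real_discrepancy_setD // -/G.
- have := dP (b n) 0%R (b01 n) ltac:(lra); have := dP (b n) a2 (b01 n) a2b.
  by rewrite !lee_fin => h1 h0; apply: le_trans (ler_normB _ _) _; lra.
- by apply: PI => //; case/andP: (b01 n).
- move=> [u v]; rewrite /P /= !in_itv /= => -[uP vP]; split => //; lra.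
Unshelve. all: by end_near. Qed.

(** * Integer shifts of the points *)

(** Such a [k] lies between [- u] and [1 - u], which leaves at most two integers. *)
Lemma finite_int_translates (R : realType) (u : R) :
  finite_set [set k : int | (0 <= u + k%:~R <= 1)%R].
Proof.
apply: (@sub_finite_set _ _ [set Num.ceil (- u); Num.ceil (- u) + 1]%R).
  move=> k /= /andP[k0 k1].
  have h1 : (Num.ceil (- u) <= k)%R by rewrite ceil_le_int; lra.
  have h2 : (k < Num.ceil (- u) + 2)%R.
    rewrite -(@ltr_int R) rmorphD /=; have := ceil_ge (- u)%R; lra.
  have [->|kN] := eqVneq k (Num.ceil (- u)); [by left|right; lia].
exact: finite_set2.
Qed.

(** The finite set [F] collects the shifts that bring some point into the square, and [L] applies
    each of them to all points. Entries of [L] outside the square are harmless, as [S] does not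
    contain them. *)
Lemma shifted_countE (R : realType) (N : nat) (x : N.-tuple (R * R)) :
  exists L : seq (R * R), forall S, S `<=` @unit_square R ->
    \esum_(m in [set: int * int])
      (\sum_(i < N) \1_S (int_shift (tnth x i) m) : R)%R%:E =
    (\sum_(p <- L) \1_S p : R)%R%:E.
Proof.
pose F := \bigcup_(i in [set: 'I_N])
  [set m | @unit_square R (int_shift (tnth x i) m)].
have finF : finite_set F.
  apply: bigcup_finite => // i _; set p := tnth x i.
  apply: (@sub_finite_set _ _
    ([set k : int | (0 <= p.1 + k%:~R <= 1)%R] `*`
     [set k : int | (0 <= p.2 + k%:~R <= 1)%R])).
    by move=> m; rewrite /unit_square /= !in_itv.
  by apply: finite_setX; exact: finite_int_translates.
exists [seq int_shift (tnth x i) m |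
  m <- finmap.enum_fset (fset_set F), i <- enum 'I_N] => S SI.
rewrite big_allpairs_dep /= -sumEFin -(fsbig_finite _ _ finF).
rewrite -esum_fset //; last first.
  by move=> m _; rewrite lee_fin; apply: sumr_ge0 => i _; rewrite indicE.
rewrite [RHS]esum_mkcond; apply: eq_esum => m _.
rewrite big_enum /=; case: ifPn => // /negP mF; congr EFin.
rewrite big1 // => i _; rewrite indicE memNset // => /SI Sm; apply: mF.
by rewrite inE; exists i.
Qed.

Theorem lemma1 (R : realType) (N : nat) (x : N.-tuple (R * R))
    (N_gt0 : (0 < N)%N) (x_in : forall i : 'I_N, T_PC (tnth x i)) :
  PC_discrepancy x
    <= 2%:E * parallelogram_discrepancy x (0, 0)%R (0, 1)%R (1, 1)%R /\
  shifted_PC_discrepancy x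
    <= 2%:E * shifted_parallelogram_discrepancy x (0, 0)%R (0, 1)%R (1, 1)%R.
Proof.
have mT := @measurable_T_PC R; have [r rE] := vol_ratioE mT; split.
  apply: (@anchored_discrepancy_le _ _ r (N%:R^-1)%R x) mT _ => S mS SI.
  by rewrite /local_discrepancy rE // /real_discrepancy EFinB big_tuple.
have [L LE] := shifted_countE x.
apply: (@anchored_discrepancy_le _ _ r (N%:R^-1)%R L) mT _ => S mS SI.
by rewrite /shifted_local_discrepancy rE // LE // /real_discrepancy EFinB EFinM.
Qed.
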